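(* Let $E$ be a finite-dimensional real inner-product space, let $U\subset E$ be a nonempty finite set with $0\in\operatorname{conv}U$, and let $A\colon E\to E$ be linear with $\langle Ax,x\rangle\ge\mu\|x\|^2$ for all $x\in E$, for some $\mu>0$. Then there is a constant $C_{\mathrm w}=C_{\mathrm w}(E,U,A)\ge1$, depending only on $E,U,A$, such that the following holds. Let $\overline w\ge0$ and $B\ge0$, and suppose that $(z_k)_{k\ge0}$ in $E$, real numbers $(w_k)_{k\ge0}$ and vectors $(u_k)_{k\ge0}$ satisfy, for every integer $k\ge0$, $$z_{k+1}=z_k+w_ku_k,\qquad 0\le w_k\le\overline w,\qquad u_k\in U,$$ and $$\langle Az_k,u_k\rangle\le\min_{u\in U}\langle Az_k,u\rangle+B.$$ Then $$\sup_{k\ge0}\|z_k\|\le C_{\mathrm w}\bigl(\overline w+\|z_0\|+B\bigr).$$ The same bound (with the same constant) holds for any finite recursion $z_0,\dots,z_N$ satisfying these conditions at every update $0\le k<N$, with the supremum taken over its state indices $0\le k\le N$. No monotonicity or positive lower bound on the weights is required.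
   Context: $\|\cdot\|$ is the norm induced by the inner product of $E$. *)

(* Defs.v *)
From mathcomp Require Import all_boot all_order all_algebra.
From mathcomp Require Import sesquilinear.
From mathcomp Require Import boolp classical_sets functions cardinality.
From mathcomp Require Import reals ereal convex.

Set Implicit Arguments.
Unset Strict Implicit.
Unset Printing Implicit Defensive.

Import Order.TTheory GRing.Theory Num.Theory.

Local Open Scope classical_set_scope.
Local Open Scope ring_scope.

(* A finite-dimensional real inner-product space is a [vectType] over a
   [realType] with a positive-definite symmetric form [ip : {dot E for idfun}]. *)
Definition ipnorm (R : realType) (E : vectType R) (ip : {dot E for idfun})
  (x : E) : R := Num.sqrt (ip x x).

Definition conv_hull (R : realType) (E : vectType R) (U : set E) : set E :=
  smallest (@convex_set R E) U.

(* [inf] is total: it is the minimum when [U] is nonempty and finite, the only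
   case in which this is used. *)
Definition min_over (R : realType) (E : vectType R) (U : set E) (f : E -> R)
  : R := inf [set f u | u in U].

Definition admissible_update (R : realType) (E : vectType R)
    (ip : {dot E for idfun}) (U : set E) (A : {linear E -> E}) (wbar B : R)
    (z : nat -> E) (w : nat -> R) (u : nat -> E) (k : nat) : Prop :=
  [/\ z k.+1 = z k + w k *: u k,
      0 <= w k <= wbar,
      U (u k) &
      ip (A (z k)) (u k) <= min_over U (fun v => ip (A (z k)) v) + B].

(* The supremum is taken in the extended reals, as the real-valued [sup] of an
   unbounded set is [0]. *)
Definition sup_norm (R : realType) (E : vectType R) (ip : {dot E for idfun})
    (K : set nat) (z : nat -> E) : \bar R :=
  ereal_sup [set (ipnorm ip (z k))%:E | k in K].

(* Main.v *)
From HB Require Import structures.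
Require Import Defs.
From mathcomp Require Import all_boot all_order all_algebra.
From mathcomp Require Import sesquilinear.
From mathcomp Require Import boolp classical_sets functions cardinality.
From mathcomp Require Import reals ereal convex.
From mathcomp Require Import interval_inference ring lra.

(** The Lyapunov function is h(z) = - min over u in U of <A z, u>, called [pot]
below; it is nonnegative because 0 lies in the convex hull of U. In continuous
time, where z' = u is a minimizer, h decreases along the motion at the rate
<A u, u> >= mu |u|^2. With finite steps the minimizer switches all the time, and
the estimate has to be made on windows of steps rather than on single steps.
Everything is measured in units of M = wbar + |z_0| + B. The slack
<A z, u> - min over u' of <A z, u'> of a direction u is at most M at each step
that uses u.

The basic remark concerns two states s < t at which all directions of a set V
have slack at most sigma M, while only directions of V are used in between. With
a = z_t - z_s, all the numbers <A a, u>, u in V, then agree with h(z_s) - h(z_t)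
up to sigma M. As a is a combination of these u with nonnegative weights of sum
T, coercivity gives mu |a|^2 <= <A a, a> <= T (h(z_s) - h(z_t) + sigma M). When
some linear form is at least 1 on V, also T is at most a constant times |a|,
so that T is at most a constant times h(z_s) - h(z_t) + sigma M: the potential
decreases linearly in time. When no form is positive on V, small slacks on V
make h itself small.

Step 1 ([decays], [decays_step]): as long as h > K M, the potential decreases at
a linear rate, up to an error of order M. This goes by induction on the set V of
directions in use. Cut the window as soon as all of V has been used; the block
before the cut uses a proper subset of V, hence falls under the induction
hypothesis. A short block ends in a state where all of V has small slack, since
slacks move slowly; a long block decreases h by more than the error. So the
basic remark applies between the first and the last state with small slacks, and
the errors of the blocks outside are absorbed ([unsynced_decay]). Hence h stays
bounded by a multiple of M ([pot_bounded]).

Step 2 ([confines], [confines_step]): once h is of order M, so is the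
displacement over every window, whatever its duration. By the same induction,
the first block that exhausts V and the last one have displacement of order M,
so the state at the end of the first and the state at the beginning of the last
have slack of order M on all of V. For their difference a, all <A a, u> with u
in V are thus of order M; as a lies in the span of V, on which A is definite,
these numbers determine a linearly ([definite_reconstruction]). *)

Set Implicit Arguments.
Unset Strict Implicit.

Import Order.TTheory GRing.Theory Num.Theory.

Local Open Scope classical_set_scope.
Local Open Scope ring_scope.

(** * Inner products *)
Section InnerProduct.
Variables (R : realType) (E : vectType R) (ip : {dot E for idfun}).
Implicit Types (x y z : E).

Lemma ipC x y : ip x y = ip y x.
Proof. by rewrite [LHS](@hermC R false idfun E ip) expr0 mul1r. Qed.

Lemma ipDl x y z : ip (x + y) z = ip x z + ip y z.
Proof. exact: linearDl. Qed.
Lemma ipBl x y z : ip (x - y) z = ip x z - ip y z.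
Proof. exact: linearBl. Qed.
Lemma ipZl c x y : ip (c *: x) y = c * ip x y.
Proof. by rewrite linearZl_LR. Qed.
Lemma ip_suml (I : Type) (r : seq I) (P : pred I) (F : I -> E) y :
  ip (\sum_(i <- r | P i) F i) y = \sum_(i <- r | P i) ip (F i) y.
Proof. exact: (linear_sum (applyr ip y)). Qed.
Lemma ip_sumr (I : Type) (r : seq I) (P : pred I) (F : I -> E) y :
  ip y (\sum_(i <- r | P i) F i) = \sum_(i <- r | P i) ip y (F i).
Proof. exact: (linear_sum (ip y)). Qed.
Lemma ipDr x y z : ip z (x + y) = ip z x + ip z y.
Proof. by rewrite ![ip z _]ipC ipDl. Qed.
Lemma ipZr c x y : ip y (c *: x) = c * ip y x.
Proof. by rewrite ![ip y _]ipC ipZl. Qed.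
Lemma ip_gt0 x : x != 0 -> 0 < ip x x.
Proof. exact: neq0_dnorm_gt0. Qed.
Lemma ip_ge0 x : 0 <= ip x x.
Proof.
have [->|/ip_gt0/ltW//] := eqVneq x 0.
by rewrite -(scale0r 0) ipZl mul0r.
Qed.
Lemma ipnorm_sqr x : ipnorm ip x ^+ 2 = ip x x.
Proof. by rewrite /ipnorm sqr_sqrtr // ip_ge0. Qed.
Lemma ipnorm_ge0 x : 0 <= ipnorm ip x.
Proof. exact: sqrtr_ge0. Qed.
Lemma ipnorm_eq0 x : ipnorm ip x = 0 -> x = 0.
Proof.
move=> x0; apply/eqP; apply: contraT => /ip_gt0.
by rewrite -ipnorm_sqr x0 expr0n ltxx.
Qed.
Lemma cauchy_schwarz x y : `|ip x y| <= ipnorm ip x * ipnorm ip y.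
Proof.
rewrite -ler_sqr ?nnegrE ?mulr_ge0 ?ipnorm_ge0 // exprMn !ipnorm_sqr.
rewrite real_normK ?num_real //.
have [->|y0] := eqVneq y 0.
  by rewrite -(scale0r 0) !ipZr !mul0r expr0n mulr0.
have := ip_ge0 (ip y y *: x - ip x y *: y).
have -> : ip (ip y y *: x - ip x y *: y) (ip y y *: x - ip x y *: y)
   = ip y y * (ip x x * ip y y - ip x y ^+ 2).
  rewrite ipBl -!scaleNr !ipDr !ipZr !ipZl (ipC y x); ring.
by rewrite pmulr_rge0 ?ip_gt0 // subr_ge0.
Qed.
Lemma ipnorm_triangle x y : ipnorm ip (x + y) <= ipnorm ip x + ipnorm ip y.
Proof.
rewrite -ler_sqr ?nnegrE ?addr_ge0 ?ipnorm_ge0 // sqrrD !ipnorm_sqr.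
rewrite ipDl !ipDr (ipC y x) -!ipnorm_sqr.
have := cauchy_schwarz x y; rewrite ler_norml => /andP[_]; lra.
Qed.
Lemma ipnormZ c x : ipnorm ip (c *: x) = `|c| * ipnorm ip x.
Proof.
by rewrite /ipnorm ipZl ipZr mulrA -expr2 sqrtrM ?sqr_ge0 // sqrtr_sqr.
Qed.
Lemma ipnormN x : ipnorm ip (- x) = ipnorm ip x.
Proof. by rewrite -scaleN1r ipnormZ normrN1 mul1r. Qed.

Lemma ipnorm_sum (I : Type) (r : seq I) (P : pred I) (F : I -> E) :
  ipnorm ip (\sum_(i <- r | P i) F i) <= \sum_(i <- r | P i) ipnorm ip (F i).
Proof.
elim/big_rec2: _ => [|i y x _ h]; first by rewrite -(scale0r 0) ipnormZ normr0 mul0r.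
by apply: (le_trans (ipnorm_triangle _ _)); rewrite lerD2l.
Qed.

(** On the span W of the [f i], the linear map sending a to the family of the
[ip (A a) (f i)] is injective: if it vanishes at a, then [A a] is orthogonal to
W, and in particular to a. A left inverse of it, evaluated on the standard
basis, gives the vectors [d i]. *)
Lemma definite_reconstruction (A : {linear E -> E}) (I : finType) (f : I -> E)
    (V : {set I}) :
  (forall x, ip (A x) x = 0 -> x = 0) ->
  exists d : I -> E, forall a, a \in <<[seq f i | i in V]>>%VS ->
    a = \sum_(i in V) ip (A a) (f i) *: d i.
Proof.
move=> Adef.
set W := <<_>>%VS.
pose phi0 (x : subvs_of W) : {ffun I -> R^o} :=
  [ffun i => if i \in V then ip (A (vsval x)) (f i) else 0].
have phi_lin : linear phi0.
  move=> c /= x y; apply/ffunP => i; rewrite !ffunE; case: ifP => _.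
    by rewrite !linearD !linearZ /= ipDl ipZl.
  by rewrite scaler0 addr0.
pose phiL := GRing.isLinear.Build _ _ _ _ phi0 phi_lin.
pose phi : {linear subvs_of W -> {ffun I -> R^o}} := HB.pack phi0 phiL.
have phi0E (x : subvs_of W) : linfun phi x = phi0 x by rewrite lfunE.
have inj : lker (linfun phi) == 0%VS.
  rewrite -subv0; apply/subvP => /= x; rewrite memv_ker memv0 phi0E => /eqP x0.
  apply/eqP/val_inj; rewrite [RHS](linear0 (@vsval _ _ W)); apply: Adef.
  have xW := subvsP x.
  change (ip (A (vsval x)) (vsval x) = 0).
  rewrite [X in ip _ X](coord_span xW) ip_sumr big1 // => i _.
  rewrite ipZr; set b := _`_i.
  have : b \in [seq f i | i in V] by apply: mem_nth; rewrite size_tuple.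
  move=> bI; have [j jV ->] := @fintype.imageP _ _ f V b bI.
  have : phi0 x j = 0 by rewrite x0 ffunE.
  by rewrite ffunE jV => ->; rewrite mulr0.
pose del (i : I) : {ffun I -> R^o} := [ffun j => (j == i)%:R].
exists (fun i => vsval ((linfun phi)^-1%VF (del i))) => a aW.
have {1}-> : a = vsval (Subvs aW) by [].
rewrite -[in LHS](lker0_lfunK inj (Subvs aW)) phi0E.
have -> : phi0 (Subvs aW) = \sum_(i in V) (ip (A a) (f i) : R^o) *: del i.
  apply/ffunP => j; rewrite !ffunE /= sum_ffunE.
  under eq_bigr do rewrite !ffunE.
  case: ifP => jV.
    rewrite (bigD1 j) //= eqxx big1 ?addr0 => [|k /andP[_ kj]].
      by rewrite /GRing.scale /= mulr1.
    by rewrite eq_sym (negPf kj) /GRing.scale /= mulr0.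
  rewrite big1 // => k kV; case: eqP => [jk|_]; last by rewrite /GRing.scale /= mulr0.
  by rewrite jk kV in jV.
by rewrite !linear_sum; apply: eq_bigr => i _; rewrite !linearZ.
Qed.

End InnerProduct.

(** * Choosing constants over a finite type *)
Lemma uniform_constant (R : realType) (T : finType) (P : T -> R -> Prop) :
  (forall t K K', K <= K' -> P t K -> P t K') ->
  (forall t, exists K, P t K) -> exists2 K, 1 <= K & forall t, P t K.
Proof.
move=> mono ex; have [c cP] := choice ex.
exists (1 + \sum_t `|c t|); first by rewrite lerDl sumr_ge0.
move=> t; apply: (mono t (c t)) => //; rewrite (bigD1 t) //=.
have := ler_norm (c t).
have : 0 <= \sum_(i | i != t) `|c i| by apply: sumr_ge0.
lra.
Qed.

(** Well-founded induction for statements that hold with some constant: at each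
step, finitely many proper subsets are involved, so one constant serves for all
of them. *)
Lemma subset_induction (R : realType) (I : finType) (P : {set I} -> R -> Prop) :
  (forall (V : {set I}) K K', K <= K' -> P V K -> P V K') ->
  (forall (V : {set I}) K, 1 <= K -> (forall W : {set I}, W \proper V -> P W K) ->
     exists K', P V K') ->
  exists2 K, 1 <= K & forall V : {set I}, P V K.
Proof.
move=> mono step; apply: uniform_constant => // V.
elim: {V}_.+1 {-2}V (ltnSn #|V|) => // n IH V Vn.
have [t K K' KK' h pr | W | K K1 KP] := @uniform_constant R {set I}
    (fun W K => W \proper V -> P W K).
- exact: mono KK' (h pr).
- have [pr|_] := boolP (W \proper V); last by exists 0.
  have [|K WK] := IH W; last by exists K.
  exact: leq_trans (proper_card pr) _.
- exact: step K1 KP.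
Qed.

(** * The potential and the runs *)
Section Dynamics.
Variables (R : realType) (E : vectType R) (ip : {dot E for idfun}).
Variables (A : {linear E -> E}) (I : finType) (f : I -> E) (i0 : I).

Definition gain (x : E) (i : I) : R := ip (A x) (f i).
Definition pot (x : E) : R := - min_over (range f) (fun v => ip (A x) v).
Definition slack (x : E) (i : I) : R := gain x i + pot x.

Lemma slack_ge0 x i : 0 <= slack x i.
Proof.
rewrite /slack /pot subr_ge0 /min_over; apply: ge_inf.
  exists (- \sum_j `|gain x j|) => _ [_ [j _ <-] <-].
  rewrite -[leRHS]opprK lerN2 (bigD1 j) //= /gain -normrN.
  have := ler_norm (- ip (A x) (f j)).
  have : 0 <= \sum_(k | k != j) `|ip (A x) (f k)| by apply: sumr_ge0.
  lra.
by exists (f i) => //; exists i.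
Qed.

Lemma pot_le x c : (forall i, - gain x i <= c) -> pot x <= c.
Proof.
move=> h; rewrite /pot lerNl /min_over; apply: lb_le_inf.
  by exists (ip (A x) (f i0)), (f i0) => //; exists i0.
by move=> _ [_ [j _ <-] <-]; rewrite lerNl; exact: h.
Qed.

Lemma pot_lipschitz x y c : (forall i, `|gain x i - gain y i| <= c) ->
  `|pot x - pot y| <= c.
Proof.
move=> h; rewrite ler_norml; apply/andP; split.
- suff : pot y <= pot x + c by lra.
  apply: pot_le => i; have := slack_ge0 x i; have := h i.
  by rewrite ler_norml /slack => /andP[]; lra.
- suff : pot x <= pot y + c by lra.
  apply: pot_le => i; have := slack_ge0 y i; have := h i.
  by rewrite ler_norml /slack => /andP[]; lra.
Qed.

Lemma slack_lipschitz x y c : (forall i, `|gain x i - gain y i| <= c) ->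
  forall i, slack x i <= slack y i + 2 * c.
Proof.
move=> h i; have := pot_lipschitz h; have := h i.
by rewrite !ler_norml /slack => /andP[? ?] /andP[? ?]; lra.
Qed.

(** The direction at step [k] is recorded by its index [v k], so that the induction
can run over sets of indices, and one number [M] bounds both the weights and the
defect of optimality. *)
Definition run (M : R) (N : nat) (z : nat -> E) (w : nat -> R) (v : nat -> I) :=
  forall k, (k < N)%N ->
    [/\ z k.+1 = z k + w k *: f (v k), 0 <= w k <= M & slack (z k) (v k) <= M].

Definition elapsed (w : nat -> R) i j := \sum_(i <= k < j) w k.

Definition used (v : nat -> I) i j : {set I} :=
  [set a in [seq v k | k <- index_iota i j]].

Lemma usedP v i j a :
  reflect (exists2 k, (i <= k < j)%N & a = v k) (a \in used v i j).
Proof.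
rewrite inE; apply: (iffP mapP) => -[k].
  by rewrite mem_index_iota; exists k.
by move=> kij ak; exists k; rewrite ?mem_index_iota.
Qed.

Lemma used_sub v i j i' j' : (i <= i')%N -> (j' <= j)%N ->
  used v i' j' \subset used v i j.
Proof.
move=> ii jj; apply/fintype.subsetP => a /usedP[k /andP[ik kj] ->].
by apply/usedP; exists k => //; rewrite (leq_trans ii) // (leq_trans kj).
Qed.

(** Step [e] is the first at which the last missing direction appears. *)
Lemma first_exhaustion v i j : (i < j)%N -> exists e,
  [/\ (i <= e < j)%N, used v i j \subset used v i e.+1 &
      used v i e \proper used v i j].
Proof.
move=> ij; have ex : exists e, (i <= e)%N && (used v i j \subset used v i e).
  by exists j; rewrite ltnW ?subxx.
case: (ex_minnP ex) => e /andP[ie sub] emin.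
have ej : (e <= j)%N by apply: emin; rewrite ltnW ?subxx.
have ne : i != e.
  apply: contraTneq sub => <-; apply/negP => /fintype.subsetP/(_ (v i)).
  have -> : v i \in used v i j by apply/usedP; exists i => //; rewrite leqnn.
  by case/(_ isT)/usedP => k /andP[/leq_ltn_trans h /h]; rewrite ltnn.
have {ne}ie : (i < e)%N by rewrite ltn_neqAle ne.
case: e ie ej sub emin => // e ie ej sub emin; exists e; split=> //.
  by rewrite ej andbT -ltnS.
rewrite properE used_sub ?(ltnW ej) //=; apply/negP => sube.
by have := emin e; rewrite -ltnS ie sube ltnn => /(_ isT).
Qed.

Lemma last_exhaustion v i j : (i < j)%N -> exists t,
  [/\ (i <= t < j)%N, used v i j \subset used v t j &
      used v t.+1 j \proper used v i j].
Proof.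
move=> ij; have ex : exists t, (t <= j)%N && (used v i j \subset used v t j).
  by exists i; rewrite ltnW ?subxx.
have ub t : (t <= j)%N && (used v i j \subset used v t j) -> (t <= j)%N.
  by case/andP.
case: (ex_maxnP ex ub) => t /andP[_ sub] tmax.
have it : (i <= t)%N by apply: tmax; rewrite ltnW ?subxx.
have tj : (t < j)%N.
  have /usedP[k /andP[/leq_ltn_trans h /h//]] : v i \in used v t j.
  by apply: (fintype.subsetP sub); apply/usedP; exists i => //; rewrite leqnn.
exists t; split=> //; first by rewrite it.
rewrite properE used_sub ?(leq_trans it) //=; apply/negP => subt.
by have := tmax t.+1; rewrite tj subt ltnn => /(_ isT).
Qed.

Lemma elapsed_cat w i j k : (i <= j <= k)%N ->
  elapsed w i k = elapsed w i j + elapsed w j k.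
Proof. by case/andP => ij jk; rewrite /elapsed (big_cat_nat ij jk). Qed.

Section Run.
Variables (M : R) (N : nat) (z : nat -> E) (w : nat -> R) (v : nat -> I).
Hypothesis runP : run M N z w v.

Lemma elapsed_ge0 i j : (j <= N)%N -> 0 <= elapsed w i j.
Proof.
move=> jN; rewrite /elapsed big_nat_cond sumr_ge0 // => k.
by rewrite andbT => /andP[_ kj]; case: (runP (leq_trans kj jN)) => _ /andP[].
Qed.

Lemma elapsed1 i : (i < N)%N -> elapsed w i i.+1 <= M.
Proof. by move=> iN; rewrite /elapsed big_nat1; case: (runP iN) => _ /andP[]. Qed.

Lemma displacement i j : (i <= j <= N)%N ->
  z j - z i = \sum_(i <= k < j) w k *: f (v k).
Proof.
case/andP => ij jN; rewrite -(telescope_sumr z ij).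
apply: eq_big_nat => k /andP[_ kj].
by case: (runP (leq_trans kj jN)) => -> _ _; rewrite addrC addKr.
Qed.

(** The displacement is a combination of the directions used, with nonnegative
weights of total mass [elapsed w i j]. *)
Lemma ip_displacement_ub x i j X : (i <= j <= N)%N ->
  (forall a, a \in used v i j -> ip x (f a) <= X) ->
  ip x (z j - z i) <= elapsed w i j * X.
Proof.
move=> ijN h; rewrite displacement // ip_sumr /elapsed mulr_suml.
apply: ler_sum_nat => k kij; rewrite ipZr.
case/andP: ijN => ij jN; case/andP: (kij) => ik kj.
case: (runP (leq_trans kj jN)) => _ /andP[w0 _] _.
by apply: ler_wpM2l => //; apply: h; apply/usedP; exists k.
Qed.

End Run.

Lemma gain_lipschitz_elapsed : exists2 L : R, 0 <= L &
  forall M N z w v, run M N z w v -> forall i j, (i <= j <= N)%N ->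
    forall a, `|gain (z j) a - gain (z i) a| <= elapsed w i j * L.
Proof.
exists (\sum_(p : I * I) `|ip (A (f p.1)) (f p.2)|); first exact: sumr_ge0.
set L := \sum_p _; move=> M N z w v rP i j ijN a.
have Lub b : `|ip (A (f b)) (f a)| <= L.
  by rewrite /L (bigD1 (b, a)) //= lerDl sumr_ge0.
rewrite /gain -ipBl -linearB (displacement rP) // linear_sum ip_suml.
apply: (le_trans (ler_norm_sum _ _ _)); rewrite /elapsed mulr_suml.
apply: ler_sum_nat => k /andP[_ kj]; rewrite linearZ ipZl normrM.
case/andP: ijN => ij jN; case: (rP k (leq_trans kj jN)) => _ /andP[w0 _] _.
by rewrite (ger0_norm w0) ler_wpM2l.
Qed.

(** In finite dimension the functionals [gain ^~ a] are bounded for [ipnorm]: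
reconstruct a vector from its inner products with a basis. *)
Lemma gain_lipschitz_norm : exists2 L : R, 0 <= L &
  forall x y a, `|gain x a - gain y a| <= ipnorm ip (x - y) * L.
Proof.
have idN (x : E) : ip ((idfun : {linear E -> E}) x) x = 0 -> x = 0.
  by rewrite /= => x0; apply: (@ipnorm_eq0 _ _ ip); rewrite /ipnorm x0 sqrtr0.
pose b (i : 'I_(\dim {:E})) : E := (vbasis fullv)`_i.
have [d dP] := definite_reconstruction b [set: _] idN.
have full x : x \in <<[seq b i | i in [set: 'I_(\dim {:E})]%SET]>>%VS.
  have : x \in <<vbasis {:E}>>%VS by rewrite (span_basis (vbasisP _)) memvf.
  apply: subvP x; apply: sub_span => y /(nthP 0)[i].
  rewrite size_tuple => ilt <-; apply/mapP; exists (Ordinal ilt) => //.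
  by rewrite mem_enum inE.
exists (\sum_a \sum_i ipnorm ip (b i) * `|gain (d i) a|).
  by apply: sumr_ge0 => a _; apply: sumr_ge0 => i _; rewrite mulr_ge0 // ipnorm_ge0.
move=> x y a; rewrite /gain -ipBl -linearB; set u := x - y.
apply: (@le_trans _ _
  (ipnorm ip u * \sum_i ipnorm ip (b i) * `|gain (d i) a|)); last first.
  rewrite ler_wpM2l ?ipnorm_ge0 // [leRHS](bigD1 a) //= lerDl.
  by apply: sumr_ge0 => c _; apply: sumr_ge0 => i _; rewrite mulr_ge0 // ipnorm_ge0.
rewrite {1}(dP u (full u)) linear_sum ip_suml.
apply: (le_trans (ler_norm_sum _ _ _)); rewrite mulr_sumr.
rewrite big_mkcond; apply: ler_sum => i _; rewrite inE linearZ ipZl normrM mulrA.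
by rewrite ler_wpM2r // cauchy_schwarz.
Qed.

Variable mu : R.
Hypothesis mu_gt0 : 0 < mu.
Hypothesis coer : forall x : E, mu * ipnorm ip x ^+ 2 <= ip (A x) x.

(** Let T be the elapsed time and a the displacement. Coercivity gives
mu |a|^2 <= T X, and testing against y gives T <= |y| |a|; eliminate |a|. *)
Lemma separated_elapsed (V : {set I}) :
  (exists y, forall a, a \in V -> 1 <= ip y (f a)) ->
  exists2 K : R, 0 <= K & forall M N z w v, run M N z w v ->
    forall s t X, (s <= t <= N)%N -> used v s t \subset V -> 0 < elapsed w s t ->
    (forall a, a \in V -> gain (z t - z s) a <= X) -> elapsed w s t <= K * X.
Proof.
move=> [y yP]; exists (ipnorm ip y ^+ 2 / mu).
  by rewrite divr_ge0 ?sqr_ge0 // ltW.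
move=> M N z w v rP s t X stN uV Tpos gX.
set T := elapsed w s t in Tpos *; set a := z t - z s.
have T0 := ltW Tpos.
have aX : mu * ipnorm ip a ^+ 2 <= T * X.
  apply: (le_trans (coer a)); apply: (ip_displacement_ub rP) => // b bu.
  by apply: gX; apply: (fintype.subsetP uV).
have Ty : T <= ipnorm ip y * ipnorm ip a.
  suff : ip (- y) a <= T * - 1.
    rewrite -scaleN1r ipZl; have := cauchy_schwarz ip y a.
    by rewrite ler_norml => /andP[_]; lra.
  apply: (ip_displacement_ub rP) => // b bu.
  by rewrite -scaleN1r ipZl mulN1r lerN2 yP // (fintype.subsetP uV).
rewrite mulrAC ler_pdivlMr // -(ler_pM2l Tpos).
have : T ^+ 2 <= ipnorm ip y ^+ 2 * ipnorm ip a ^+ 2.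
  by rewrite -exprMn ler_sqr ?nnegrE // mulr_ge0 ?ipnorm_ge0.
have : ipnorm ip y ^+ 2 * (mu * ipnorm ip a ^+ 2) <= ipnorm ip y ^+ 2 * (T * X).
  by rewrite ler_wpM2l ?sqr_ge0.
move=> h1 h2; have -> : T * (T * mu) = mu * T ^+ 2 by ring.
have -> : T * (ipnorm ip y ^+ 2 * X) = ipnorm ip y ^+ 2 * (T * X) by ring.
by apply: le_trans h1; rewrite [leRHS]mulrCA ler_pM2l.
Qed.

Lemma weaken_rate (T X K K' C C' : R) : 0 <= T -> 0 < K -> K <= K' -> C <= C' ->
  T <= K * (X + C) -> T <= K' * (X + C').
Proof.
move=> T0 K0 KK' CC' TX; apply: (le_trans TX).
have Y0 : 0 <= X + C by rewrite -(pmulr_rge0 _ K0) (le_trans T0).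
by apply: ler_pM => //; rewrite ?lerD2l // ltW.
Qed.

(** * Linear decrease of the potential *)
Definition synced (V : {set I}) (c : R) (x : E) := forall a, a \in V -> slack x a <= c.

(** The restriction to windows of high potential disposes of the sets V on which no
linear form is positive: for these, time may pass without any decrease. The
additive error appears inside the product to make the property monotone in
[K]. *)
Definition decays (V : {set I}) (K : R) : Prop := 0 < K /\
  forall M N z w v, 0 <= M -> run M N z w v ->
  forall i j, (i <= j <= N)%N -> used v i j \subset V ->
    (forall k, (i <= k <= j)%N -> K * M < pot (z k)) ->
    elapsed w i j <= K * (pot (z i) - pot (z j) + K * M).

Lemma decays_mono V K K' : K <= K' -> decays V K -> decays V K'.
Proof.
move=> KK' [K0 h]; split; first exact: lt_le_trans KK'.
move=> M N z w v M0 rP i j ijN uV hi.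
have KM : K * M <= K' * M by rewrite ler_wpM2r.
have T := h M N z w v M0 rP i j ijN uV (fun k kij => le_lt_trans KM (hi k kij)).
by apply: weaken_rate KK' KM T => //; apply: (elapsed_ge0 rP); case/andP: ijN.
Qed.

Section Decay.
Variable L : R.
Hypothesis L_ge0 : 0 <= L.
Hypothesis LP : forall M N z w v, run M N z w v -> forall i j, (i <= j <= N)%N ->
    forall a, `|gain (z j) a - gain (z i) a| <= elapsed w i j * L.

Lemma elapsed_gt0 w i e : 0 < elapsed w i e -> (i < e)%N.
Proof.
by move=> T; rewrite ltnNge; apply/negP => ei; rewrite /elapsed big_geq ?ltxx in T.
Qed.

(** A block that exhausts V, run from the start of the window, lasts more than
2 K^2 M, for otherwise V would be synced at its end: over such a time, slacks
change by at most 4 L K^2 M. The induction hypothesis bounds the duration of the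
block by K (drop of potential) + K^2 M, and the error term is less than half of
this duration. Hence the block lasts at most 2 K times the drop of potential,
with no error left, and blocks can be chained without loss. Only the final
block, which does not exhaust V, contributes an error. *)
Lemma unsynced_decay (V : {set I}) K : 1 <= K ->
  (forall W : {set I}, W \proper V -> decays W K) ->
  forall M N z w v, 0 <= M -> run M N z w v ->
  forall i j, (i <= j <= N)%N -> used v i j \subset V ->
    (forall k, (i <= k <= j)%N -> K * M < pot (z k)) ->
    (forall e, (i <= e < j)%N -> ~ synced V ((1 + 4 * L * K ^+ 2) * M) (z e)) ->
    elapsed w i j <= 2 * K * (pot (z i) - pot (z j) + K * M).
Proof.
move=> K1 IHV M N z w v M0 rP i j; have K0 : 0 < K by lra.
have [n] := ubnP (j - i); elim: n i => // n IH i ln /andP[ij jN] uV hK unsync.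
have T0 a b : (b <= N)%N -> 0 <= elapsed w a b by apply: (elapsed_ge0 rP).
have KM0 : 0 <= K * (K * M) by rewrite !mulr_ge0 // ltW.
have [upr|] := boolP (used v i j \proper V).
  have [_ /(_ M N z w v M0 rP i j) h] := IHV _ upr.
  have {}h : elapsed w i j <= K * (pot (z i) - pot (z j) + K * M).
    by apply: h; rewrite ?ij.
  by have := T0 i j jN; lra.
rewrite finset.properEneq uV andbT negbK => /eqP usedV.
have [->|nij] := eqVneq i j.
  by rewrite /elapsed big_geq // subrr add0r; lra.
have [e [/andP[ie ej] Ve upr]] : exists e, [/\ (i <= e < j)%N,
    V \subset used v i e.+1 & used v i e \proper V].
  by rewrite -usedV; apply: first_exhaustion; rewrite ltn_neqAle nij.
have eN : (e <= N)%N := leq_trans (ltnW ej) jN.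
have T1 : elapsed w i e <= K * (pot (z i) - pot (z e) + K * M).
  have [_ /(_ M N z w v M0 rP i e)] := IHV _ upr; apply; rewrite ?ie ?subxx //.
  by move=> k /andP[ik ke]; apply: hK; rewrite ik (leq_trans ke) // ltnW.
have long : 2 * (K * (K * M)) < elapsed w i e.
  rewrite ltNge; apply/negP => short; apply: (unsync e); first by rewrite ie.
  move=> a aV; have /usedP[k /andP[ik ke] ->] := fintype.subsetP Ve _ aV.
  have kN : (k < N)%N by apply: leq_trans jN; apply: leq_trans ej.
  have [_ _ sk] := rP k kN.
  have keN : (k <= e <= N)%N by rewrite -ltnS ke eN.
  have := slack_lipschitz (LP rP keN) (v k).
  have ikeN : (i <= k <= e)%N by rewrite ik -ltnS.
  have : elapsed w k e <= 2 * (K * (K * M)).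
    by apply: le_trans short; rewrite (elapsed_cat _ ikeN) lerDr T0 // ltnW.
  move=> /(ler_wpM2r L_ge0); rewrite expr2; lra.
have T1pos : 0 < elapsed w i e by apply: le_lt_trans long; lra.
have lie := elapsed_gt0 T1pos.
have T2 : elapsed w e j <= 2 * K * (pot (z e) - pot (z j) + K * M).
  apply: IH.
  - by rewrite -ltnS (leq_trans _ ln) // ltnS ltn_sub2l // (leq_trans lie) // ltnW.
  - by rewrite jN ltnW.
  - by rewrite (fintype.subset_trans _ uV) // used_sub.
  - by move=> k /andP[ek kj]; apply: hK; rewrite (leq_trans ie) // kj.
  - by move=> k /andP[ek kj]; apply: unsync; rewrite (leq_trans ie) // kj.
rewrite (@elapsed_cat w i e j) ?ie ?(ltnW ej) //; lra.
Qed.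

(** If the potential exceeded c, then all gains on V would be negative, and a
negative multiple of [A x] would be at least 1 on V. *)
Lemma synced_pot (V : {set I}) c x :
  ~ (exists y, forall a, a \in V -> 1 <= ip y (f a)) -> synced V c x -> pot x <= c.
Proof.
move=> nsep sync; rewrite leNgt; apply/negP => cx; apply: nsep.
exists (- (pot x - c)^-1 *: A x) => a aV.
have d0 : 0 < pot x - c by rewrite subr_gt0.
rewrite ipZl mulNr -mulrN ler_pdivlMl // mulr1.
by have := sync a aV; rewrite /slack /gain; lra.
Qed.

(** Here the first state may be synced; only one step is needed to leave it, at
the cost of an error of order M. *)
Lemma last_stretch (V : {set I}) K : 1 <= K ->
  (forall W : {set I}, W \proper V -> decays W K) ->
  forall M N z w v, 0 <= M -> run M N z w v ->
  forall t j, (t <= j <= N)%N -> used v t j \subset V ->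
    (forall k, (t <= k <= j)%N -> K * M < pot (z k)) ->
    (forall e, (t < e < j)%N -> ~ synced V ((1 + 4 * L * K ^+ 2) * M) (z e)) ->
    elapsed w t j <= (2 * K + 1) * (pot (z t) - pot (z j) + (K + L + 1) * M).
Proof.
move=> K1 IHV M N z w v M0 rP t j tjN uV hK unsync; case/andP: (tjN) => tj jN.
have LM : 0 <= L * M by rewrite mulr_ge0.
have KM : 0 <= K * M by rewrite mulr_ge0 //; lra.
have [->|ntj] := eqVneq t j.
  have c0 : 0 <= (2 * K + 1) * ((K + L + 1) * M).
    by apply: mulr_ge0; [|apply: mulr_ge0 => //]; have := L_ge0; lra.
  by rewrite /elapsed big_geq // subrr add0r.
have ltj : (t < j)%N by rewrite ltn_neqAle ntj.
have tN : (t < N)%N := leq_trans ltj jN.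
have T1 := elapsed1 rP tN.
have T10 : 0 <= elapsed w t t.+1 by apply: (elapsed_ge0 rP).
have T20 : 0 <= elapsed w t.+1 j by apply: (elapsed_ge0 rP).
have ttN : (t <= t.+1 <= N)%N by rewrite leqnSn.
have := pot_lipschitz (LP rP ttN).
rewrite ler_norml => /andP[_ h1].
have h2 : elapsed w t t.+1 * L <= L * M by rewrite mulrC ler_wpM2l.
have T2 : elapsed w t.+1 j <= 2 * K * (pot (z t.+1) - pot (z j) + K * M).
  apply: (unsynced_decay K1 IHV M0 rP).
  - by rewrite ltj.
  - by rewrite (fintype.subset_trans _ uV) // used_sub.
  - by move=> k /andP[tk kj]; apply: hK; rewrite (ltnW tk) kj.
  - by move=> k /andP[tk kj]; apply: unsync; rewrite tk kj.
rewrite (@elapsed_cat w t t.+1 j) ?leqnSn //.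
have K2 : 0 < 2 * K by lra.
have Y0 : 0 <= pot (z t.+1) - pot (z j) + K * M.
  by rewrite -(pmulr_rge0 _ K2) (le_trans T20).
apply: (@le_trans _ _ ((2 * K + 1) * (pot (z t.+1) - pot (z j) + K * M + M))).
  move: Y0 T2; set Y := (_ + K * M) => Y0 T2.
  lra.
by apply: ler_wpM2l; lra.
Qed.

Lemma decays_step (V : {set I}) K : 1 <= K ->
  (forall W : {set I}, W \proper V -> decays W K) -> exists K', decays V K'.
Proof.
move=> K1 IHV; have L0 := L_ge0; set sg := 1 + 4 * L * K ^+ 2.
have sg0 : 0 < sg.
  by have : 0 <= L * K ^+ 2 by [rewrite mulr_ge0 ?sqr_ge0]; rewrite /sg; lra.
have [sep|nsep] := pselect (exists y, forall a, a \in V -> 1 <= ip y (f a)); last first.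
  exists (2 * K + sg); split; first by lra.
  move=> M N z w v M0 rP i j ijN uV hK; case/andP: (ijN) => ij jN.
  have KM : K * M <= (2 * K + sg) * M by rewrite ler_wpM2r //; lra.
  have sM : sg * M <= (2 * K + sg) * M by rewrite ler_wpM2r //; lra.
  apply: (@weaken_rate _ _ (2 * K) _ (K * M)) => //.
  - exact: (elapsed_ge0 rP).
  - by lra.
  - by lra.
  apply: (unsynced_decay K1 IHV M0 rP) => //.
    by move=> k kij; apply: le_lt_trans (hK k kij).
  move=> e /andP[ie ej] /(synced_pot nsep); rewrite leNgt => /negP; apply.
  by apply: le_lt_trans (hK e _) => //; rewrite ie ltnW.
(* The window is cut at the first and at the last synced state: blocks before
   and after, and the two-point estimate of [separated_elapsed] in between. *)
have [K2 K20 K2P] := separated_elapsed sep.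
set K' := 2 * K + K2 + sg + L + 2.
exists K'; split; first by rewrite /K'; lra.
move=> M N z w v M0 rP i j ijN uV hK'; case/andP: (ijN) => ij jN.
have hK k : (i <= k <= j)%N -> K * M < pot (z k).
  by move=> kij; apply: le_lt_trans (hK' k kij); rewrite ler_wpM2r // /K'; lra.
have T0 a b : (b <= N)%N -> 0 <= elapsed w a b by apply: (elapsed_ge0 rP).
have LM : 0 <= L * M by rewrite mulr_ge0.
have sM : 0 <= sg * M by rewrite mulr_ge0 // ltW.
have [nosync|] := pselect (forall e, (i <= e < j)%N -> ~ synced V (sg * M) (z e)).
  apply: (@weaken_rate _ _ (2 * K) _ (K * M)) => //.
  - exact: T0.
  - by lra.
  - by rewrite /K'; lra.
  - by rewrite ler_wpM2r // /K'; lra.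
  exact: (unsynced_decay K1 IHV M0 rP).
move=> /existsNP[e0 /not_implyP[ie0 /contrapT se0]].
pose hit e := (i <= e < j)%N && `[< synced V (sg * M) (z e) >].
have ex_hit : exists e, hit e by exists e0; rewrite /hit ie0; apply/asboolP.
have hit_ub e : hit e -> (e <= j)%N by case/andP => /andP[_ /ltnW].
case: (ex_minnP ex_hit) => s /andP[/andP[si sj] /asboolP ss] smin.
case: (ex_maxnP ex_hit hit_ub) => t /andP[/andP[ti tj] /asboolP st] tmax.
have le_st : (s <= t)%N by apply: smin; rewrite /hit ti tj; apply/asboolP.
have sN : (s <= N)%N by apply: leq_trans jN; apply: ltnW.
have tN : (t <= N)%N by apply: leq_trans jN; apply: ltnW.
have T1 : elapsed w i s <= 2 * K * (pot (z i) - pot (z s) + K * M).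
  apply: (unsynced_decay K1 IHV M0 rP).
  - by rewrite si.
  - by rewrite (fintype.subset_trans _ uV) // used_sub // ltnW.
  - by move=> k /andP[ik ks]; apply: hK; rewrite ik (leq_trans ks) // ltnW.
  - move=> e /andP[ie es] se; have := smin e.
    rewrite /hit ie (ltn_trans es sj) leqNgt es /=; by move/(_ (asboolT se)).
have T3 : elapsed w t j <= (2 * K + 1) * (pot (z t) - pot (z j) + (K + L + 1) * M).
  apply: (last_stretch K1 IHV M0 rP).
  - by rewrite ltnW.
  - by rewrite (fintype.subset_trans _ uV) // used_sub.
  - by move=> k /andP[tk kj]; apply: hK; rewrite (leq_trans ti tk) kj.
  - move=> e /andP[te ej] se; have := tmax e.
    rewrite /hit (leq_trans ti (ltnW te)) ej leqNgt te /=; by move/(_ (asboolT se)).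
have stN : (s <= t <= N)%N by rewrite le_st.
(* When no time elapses between the two states, the potential has not changed;
   otherwise the sign of the right-hand side follows from the estimate. *)
have [T2 X0] : elapsed w s t <= K2 * (pot (z s) - pot (z t) + sg * M) /\
     0 <= pot (z s) - pot (z t) + sg * M.
  have [Tle|Tgt] := leP (elapsed w s t) 0.
    have := pot_lipschitz (LP rP stN).
    have : elapsed w s t * L <= 0 by rewrite mulr_le0_ge0.
    rewrite ler_norml => TL /andP[_ h].
    have X0 : 0 <= pot (z s) - pot (z t) + sg * M by lra.
    by split => //; apply: (le_trans Tle); rewrite mulr_ge0.
  have T2 : elapsed w s t <= K2 * (pot (z s) - pot (z t) + sg * M).
    apply: (K2P M N z w v rP) => //.
      by rewrite (fintype.subset_trans _ uV) // used_sub // ltnW.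
    move=> a aV; rewrite /gain linearB ipBl; have := slack_ge0 (z s) a; have := st a aV.
    by rewrite /slack /gain; lra.
  split=> //; rewrite leNgt; apply/negP => X0.
  have : K2 * (pot (z s) - pot (z t) + sg * M) <= 0 by rewrite mulr_ge0_le0 // ltW.
  by lra.
have Y1 : 0 <= pot (z i) - pot (z s) + K * M.
  by rewrite -(@pmulr_rge0 _ (2 * K)) ?(le_trans _ T1) ?T0 //; lra.
have Y3 : 0 <= pot (z t) - pot (z j) + (K + L + 1) * M.
  by rewrite -(@pmulr_rge0 _ (2 * K + 1)) ?(le_trans _ T3) ?T0 //; lra.
rewrite (@elapsed_cat w i s j) ?si ?(ltnW sj) //.
rewrite (@elapsed_cat w s t j) ?le_st ?(ltnW tj) //.
apply: (@le_trans _ _ (K' * ((pot (z i) - pot (z s) + K * M) +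
   (pot (z s) - pot (z t) + sg * M) + (pot (z t) - pot (z j) + (K + L + 1) * M)))).
  rewrite mulrDr (mulrDr K') [leLHS]addrA; apply: lerD; first apply: lerD.
  - by apply: (le_trans T1); rewrite ler_wpM2r // /K'; lra.
  - by apply: (le_trans T2); rewrite ler_wpM2r // /K'; lra.
  - by apply: (le_trans T3); rewrite ler_wpM2r // /K'; lra.
apply: ler_wpM2l; first by rewrite /K'; lra.
have : (2 * K + sg + L + 1) * M <= K' * M by rewrite ler_wpM2r // /K'; lra.
lra.
Qed.

(** After the last state below the threshold [K * M], the potential can increase by
at most the error term of [decays]. *)
Lemma pot_bounded K H M N z w v : 0 <= K -> decays [set: I]%SET K ->
  0 <= H -> 0 <= M -> run M N z w v -> pot (z 0%N) <= H * M ->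
  forall j, (j <= N)%N -> pot (z j) <= (H + 2 * K + L) * M.
Proof.
move=> K0 [K_gt0 dec] H0 M0 rP p0 j jN; have L0 := L_ge0.
have KM : 0 <= K * M by rewrite mulr_ge0.
have LM : 0 <= L * M by rewrite mulr_ge0.
have HM : 0 <= H * M by rewrite mulr_ge0.
have [pj|pj] := leP (pot (z j)) (K * M); first by lra.
pose Q s := (s <= j)%N && `[< forall k, (s <= k <= j)%N -> K * M < pot (z k) >].
have exQ : exists s, Q s.
  exists j; rewrite /Q leqnn; apply/asboolP => k /andP[jk kj].
  by have -> : k = j by apply/eqP; rewrite eqn_leq jk kj.
case: (ex_minnP exQ) => s /andP[sj /asboolP high] smin.
have sN := leq_trans sj jN.
have ps : pot (z j) <= pot (z s) + K * M.
  have T : elapsed w s j <= K * (pot (z s) - pot (z j) + K * M).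
    by apply: (dec M N z w v M0 rP) => //; rewrite ?sj ?finset.subsetT.
  have Y0 : 0 <= pot (z s) - pot (z j) + K * M.
    rewrite -(pmulr_rge0 _ K_gt0); apply: le_trans T.
    exact: (elapsed_ge0 rP).
  by lra.
case: s => [|s] in sj high smin sN ps *; first by lra.
have low : pot (z s) <= K * M.
  rewrite leNgt; apply/negP => hs; have := smin s; rewrite ltnn => /implyP.
  rewrite implybF => /negP; apply; rewrite /Q (ltnW sj); apply/asboolP.
  move=> k /andP[sk kj]; have [<-//|sk'] := eqVneq s k.
  by apply: high; rewrite kj andbT ltn_neqAle sk'.
have ssN : (s <= s.+1 <= N)%N by rewrite leqnSn.
have := pot_lipschitz (LP rP ssN).
have := elapsed1 rP sN; move/(ler_wpM2r L_ge0).
rewrite ler_norml => ? /andP[_ ?]; lra.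
Qed.

End Decay.

(** * Bounded displacement at bounded potential *)
Section Confinement.
Variables (H : R).
Hypothesis H_ge0 : 0 <= H.

Definition confines (V : {set I}) (K : R) : Prop :=
  forall M N z w v, 0 <= M -> run M N z w v ->
  forall i j, (i <= j <= N)%N -> used v i j \subset V ->
    (forall k, (i <= k <= j)%N -> 0 <= pot (z k) <= H * M) ->
    ipnorm ip (z j - z i) <= K * M.

Lemma displacement_span (V : {set I}) M N z w v i j : run M N z w v ->
  (i <= j <= N)%N -> used v i j \subset V ->
  z j - z i \in <<[seq f a | a in V]>>%VS.
Proof.
move=> rP ijN uV; rewrite (displacement rP) // big_nat_cond.
apply: rpred_sum => k /andP[kij _]; apply: rpredZ; apply: memv_span.
apply: fintype.image_f; apply: (fintype.subsetP uV); apply/usedP.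
by exists k.
Qed.

(** Unlike for [decays], no time enters: slacks are compared through the
displacement between states, which the induction hypothesis bounds inside each
block however long it lasts. So the first and the last exhausting blocks
suffice. *)
Lemma confines_step (V : {set I}) K : 1 <= K ->
  (forall W : {set I}, W \proper V -> confines W K) -> exists K', confines V K'.
Proof.
move=> K1 IHV; have [L L0 LP] := gain_lipschitz_norm.
have Adef x : ip (A x) x = 0 -> x = 0.
  move=> Ax0; apply: (@ipnorm_eq0 _ _ ip); apply/eqP; rewrite -sqrf_eq0.
  rewrite eq_le sqr_ge0 andbT -(ler_pM2l mu_gt0) mulr0.
  by rewrite (le_trans (coer x)) // Ax0.
have [d dP] := definite_reconstruction f V Adef.
set D := \sum_a ipnorm ip (f a).
have D0 : 0 <= D by apply: sumr_ge0 => a _; apply: ipnorm_ge0.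
have fD a : ipnorm ip (f a) <= D.
  by rewrite /D (bigD1 a) //= lerDl sumr_ge0 // => b _; apply: ipnorm_ge0.
set S := \sum_(a in V) ipnorm ip (d a).
set c := 1 + 2 * ((K + D) * L).
exists (K + (K + D) + (c + H) * S).
move=> M N z w v M0 rP i j ijN uV hp; case/andP: (ijN) => ij jN.
have S0 : 0 <= S by apply: sumr_ge0 => a _; apply: ipnorm_ge0.
have KDL : 0 <= (K + D) * L by rewrite mulr_ge0 //; lra.
have c0 : 0 <= c by rewrite /c; lra.
have KD0 : 0 <= K + D by lra.
have cHS : 0 <= (c + H) * S * M by rewrite !mulr_ge0 // addr_ge0.
have KM : 0 <= K * M by rewrite mulr_ge0 //; lra.
have DM : 0 <= D * M by rewrite mulr_ge0.
have HM : 0 <= H * M by rewrite mulr_ge0.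
have [upr|] := boolP (used v i j \proper V).
  have := IHV _ upr M N z w v M0 rP i j ijN (subxx _) hp; lra.
rewrite finset.properEneq uV andbT negbK => /eqP usedV.
have [->|nij] := eqVneq i j.
  rewrite subrr -(scale0r 0) ipnormZ normr0 mul0r; lra.
have lij : (i < j)%N by rewrite ltn_neqAle nij.
have sub x y : (i <= x <= y)%N -> (y <= j)%N -> used v x y \proper V ->
    ipnorm ip (z y - z x) <= K * M.
  move=> /andP[ix xy] yj upr; apply: (IHV _ upr M N z w v M0 rP) => //.
    by rewrite xy (leq_trans yj).
  by move=> k /andP[xk ky]; apply: hp; rewrite (leq_trans ix) // (leq_trans ky).
(* The slack of a direction used at step k is still small at a state x close to
   state k. *)
have near_sync x k : (k < N)%N -> ipnorm ip (z x - z k) <= (K + D) * M ->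
    slack (z x) (v k) <= c * M.
  move=> kN xk; have [_ _ sk] := rP k kN.
  have := slack_lipschitz (LP (z x) (z k)) (v k).
  by move: xk => /(ler_wpM2r L0); rewrite /c; lra.
have [e [ie ej se he]] : exists e, [/\ (i <= e)%N, (e < j)%N,
    synced V (c * M) (z e) & ipnorm ip (z e - z i) <= K * M].
  have [e [/andP[ie ej] Ve upr]] := first_exhaustion v lij.
  rewrite usedV in Ve upr.
  have prox k : (i <= k <= e)%N -> ipnorm ip (z e - z k) <= K * M.
    move=> /andP[ik ke]; apply: sub; rewrite ?ik ?ke ?(ltnW ej) //.
    by apply: fintype.sub_proper_trans upr; apply: used_sub.
  exists e; split => //; last by apply: prox; rewrite leqnn.
  move=> a aV; have /usedP[k /andP[ik ke] ->] := fintype.subsetP Ve _ aV.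
  apply: near_sync; first by rewrite (leq_trans (leq_trans ke ej)).
  by have := prox k; rewrite ik -ltnS ke => /(_ isT); lra.
have [t [it tj st ht]] : exists t, [/\ (i <= t)%N, (t < j)%N,
    synced V (c * M) (z t) & ipnorm ip (z j - z t) <= (K + D) * M].
  have [t [/andP[it tj] Vt upr]] := last_exhaustion v lij.
  rewrite usedV in Vt upr.
  have prox k : (t <= k <= j)%N -> ipnorm ip (z k - z t) <= (K + D) * M.
    move=> /andP[tk kj]; have [<-|tk'] := eqVneq t k.
      by rewrite subrr -(scale0r 0) ipnormZ normr0 mul0r mulr_ge0.
    have {}tk : (t < k)%N by rewrite ltn_neqAle tk'.
    have h1 : ipnorm ip (z k - z t.+1) <= K * M.
      apply: sub; rewrite ?kj ?tk ?(leq_trans it) //.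
      by apply: fintype.sub_proper_trans upr; apply: used_sub.
    have [zt /andP[w0 wM] _] := rP t (leq_trans tj jN).
    have h2 : ipnorm ip (z t.+1 - z t) <= D * M.
      rewrite zt addrC addKr ipnormZ ger0_norm // mulrC.
      by apply: ler_pM => //; apply: ipnorm_ge0.
    have -> : z k - z t = (z k - z t.+1) + (z t.+1 - z t) by rewrite addrA subrK.
    have := ipnorm_triangle ip (z k - z t.+1) (z t.+1 - z t); lra.
  exists t; split => //; last by apply: prox; rewrite (ltnW tj) leqnn.
  move=> a aV; have /usedP[k /andP[tk kj] ->] := fintype.subsetP Vt _ aV.
  apply: near_sync; first by rewrite (leq_trans kj).
  rewrite -ipnormN opprB; apply: prox; rewrite tk; exact: ltnW.
have Wte : z t - z e \in <<[seq f a | a in V]>>%VS.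
  have -> : z t - z e = (z t - z i) - (z e - z i) by rewrite opprB addrA subrK.
  apply: rpredB; apply: (displacement_span rP).
  - by rewrite it (leq_trans (ltnW tj)).
  - by rewrite -usedV used_sub // ltnW.
  - by rewrite ie (leq_trans (ltnW ej)).
  - by rewrite -usedV used_sub // ltnW.
(* Both slacks and both potentials are of order M, hence so are all the
   coefficients of the reconstruction of z t - z e. *)
have mid : ipnorm ip (z t - z e) <= (c + H) * S * M.
  rewrite (dP _ Wte); apply: (le_trans (ipnorm_sum _ _ _ _)).
  rewrite mulrAC /S mulr_sumr; apply: ler_sum => a aV; rewrite ipnormZ.
  apply: ler_wpM2r; first exact: ipnorm_ge0.
  have := st a aV; have := se a aV; have := slack_ge0 (z t) a.
  have := slack_ge0 (z e) a.
  have /andP[? ?] : 0 <= pot (z e) <= H * M by apply: hp; rewrite ie ltnW.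
  have /andP[? ?] : 0 <= pot (z t) <= H * M by apply: hp; rewrite it ltnW.
  by rewrite linearB ipBl /slack /gain ler_norml => *; apply/andP; split; lra.
have -> : z j - z i = (z j - z t) + ((z t - z e) + (z e - z i)).
  by rewrite !addrA !subrK.
have t1 := ipnorm_triangle ip (z j - z t) ((z t - z e) + (z e - z i)).
have t2 := ipnorm_triangle ip (z t - z e) (z e - z i).
lra.
Qed.

Lemma confines_mono (V : {set I}) K K' : K <= K' -> confines V K -> confines V K'.
Proof.
move=> KK' h M N z w v M0 rP i j ijN uV hi.
by apply: (le_trans (h M N z w v M0 rP i j ijN uV hi)); rewrite ler_wpM2r.
Qed.

End Confinement.

Theorem run_bounded : (forall x, 0 <= pot x) ->
  exists2 C : R, 1 <= C & forall M N z w v, 0 <= M -> ipnorm ip (z 0%N) <= M ->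
    run M N z w v -> forall j, (j <= N)%N -> ipnorm ip (z j) <= C * M.
Proof.
move=> pot0; have [L L0 LP] := gain_lipschitz_elapsed.
have [L' L'0 LP'] := gain_lipschitz_norm.
have [K K1 decK] := subset_induction decays_mono (decays_step L0 LP).
have K0 : 0 <= K by lra.
set H := L' + 2 * K + L.
have H0 : 0 <= H by rewrite /H; lra.
have [C C1 confC] := subset_induction (@confines_mono H) (confines_step H0).
exists (C + 1); first by lra.
move=> M N z w v M0 z0 rP j jN.
have p0 : pot (z 0%N) <= L' * M.
  apply: pot_le => i; have := LP' (z 0%N) 0 i.
  rewrite /gain subr0 linear0 => h.
  have g0 : ip 0 (f i) = 0 by rewrite -(scale0r 0) ipZl mul0r.
  move: h; rewrite /= g0 subr0 ler_norml => /andP[h _].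
  by have := ler_wpM2r L'0 z0; lra.
have hp k : (0 <= k <= j)%N -> 0 <= pot (z k) <= H * M.
  move=> /andP[_ kj]; rewrite pot0 /=.
  exact: (pot_bounded L0 LP K0 (decK _) L'0 M0 rP p0 (leq_trans kj jN)).
have h := confC [set: I]%SET M N z w v M0 rP 0%N j jN (finset.subsetT _) hp.
rewrite -[z j](subrK (z 0%N)); apply: (le_trans (ipnorm_triangle _ _ _)); lra.
Qed.

End Dynamics.

(** * The theorem *)

(** A half-space is convex. *)
Lemma conv_hull_ge (R : realType) (E : vectType R) (ip : {dot E for idfun})
    (U : set E) (p x : E) (c : R) :
  (forall u, U u -> c <= ip p u) -> conv_hull U x -> c <= ip p x.
Proof.
move=> Uc hull; apply: (hull [set v | c <= ip p v]); split => // a b l.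
rewrite !inE /= => ca cb.
have t0 : 0 <= l%:num :> R by apply: ge0.
have t1 : 0 <= 1 - l%:num :> R by rewrite subr_ge0; apply: le1.
have -> : ip p (conv l a b) = l%:num * ip p a + (1 - l%:num) * ip p b.
  by rewrite -!ipZr -ipDr.
have := ler_wpM2l t0 ca; have := ler_wpM2l t1 cb; lra.
Qed.

Theorem corollary1 (R : realType) (E : vectType R) (ip : {dot E for idfun})
    (U : set E) (A : {linear E -> E})
    (finU : finite_set U) (U0 : U !=set0) (convU : conv_hull U 0)
    (coerA : exists2 mu : R, 0 < mu &
       forall x : E, mu * ipnorm ip x ^+ 2 <= ip (A x) x) :
  exists2 Cw : R, 1 <= Cw &
    forall (wbar B : R), 0 <= wbar -> 0 <= B ->
    forall (z : nat -> E) (w : nat -> R) (u : nat -> E),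
      ((forall k : nat, admissible_update ip U A wbar B z w u k) ->
        (sup_norm ip [set: nat] z <= (Cw * (wbar + ipnorm ip (z 0%N) + B))%:E)%E)
      /\
      (forall N : nat,
        (forall k : nat, (k < N)%N -> admissible_update ip U A wbar B z w u k) ->
        (sup_norm ip [set k | (k <= N)%N] z
           <= (Cw * (wbar + ipnorm ip (z 0%N) + B))%:E)%E).
Proof.
have [s Us] := (finite_seqP U).1 finU; have [u0 Uu0] := U0.
have [mu mu0 coer] := coerA.
have su0 : u0 \in s by move: Uu0; rewrite Us.
pose f (i : seq_sub s) : E := ssval i.
have rangef : range f = U.
  rewrite Us; apply/seteqP; split => [_ [i _ <-]|x xs] /=; first exact: ssvalP.
  by exists (SeqSub xs).
have pot0 x : 0 <= pot ip A f x.
  rewrite /pot rangef oppr_ge0 -[leRHS](linear0 (ip (A x))).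
  apply: conv_hull_ge convU => v Uv.
  have := slack_ge0 ip A f x; rewrite /slack /pot /gain rangef => h.
  have vs : v \in s by move: Uv; rewrite Us.
  by have := h (SeqSub vs); rewrite subr_ge0.
have [C C1 bound] := run_bounded (SeqSub su0) mu0 coer pot0.
exists C => // wbar B wbar0 B0 z w u.
set M := wbar + ipnorm ip (z 0%N) + B.
have z0 := ipnorm_ge0 ip (z 0%N).
have fin N : (forall k, (k < N)%N -> admissible_update ip U A wbar B z w u k) ->
    forall k, (k <= N)%N -> ipnorm ip (z k) <= C * M.
  move=> adm; pose v k : seq_sub s := insubd (SeqSub su0) (u k).
  apply: (bound M N z w v); rewrite /M; [lra|lra|].
  move=> k kN; have [-> /andP[w0 wM] Uk gk] := adm k kN.
  have fv : f (v k) = u k.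
    by rewrite /f /v; apply: (@insubdK _ _ (seq_sub s)); move: Uk; rewrite Us.
  split; first by rewrite fv.
    by rewrite w0 /=; lra.
  by rewrite /slack /gain /pot fv rangef; lra.
split=> [adm|N adm]; apply: ge_ereal_sup => _ [k /= kN <-]; rewrite lee_fin.
  by apply: (fin k) => // l _; apply: adm.
exact: fin kN.
Qed.
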